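(* Let $\rho_n$ be a quantum state on $(\mathbb{C}^d)^{\otimes n}$ that is $U^{\otimes n}$-invariant, i.e. $U^{\otimes n}\rho_n(U^\dagger)^{\otimes n}=\rho_n$ for all $U\in\mathcal{U}_d$; with respect to the Schur-Weyl decomposition write $\rho_n=\bigoplus_{\lambda}\mathbb{I}_{\mathcal{V}_\lambda^d}\otimes\rho_\lambda$ with positive operators $\rho_\lambda$ on $\mathcal{W}_\lambda$. Let $\rho^\pi=P_\pi\rho_nP_\pi^\dagger$ form a geometrically uniform ensemble $(\rho^\pi)_{\pi\in S_n}$ (with uniform prior probabilities $\frac{1}{n!}$). Then the optimal success probability of state discrimination is $$p_{\mathrm{succ}}^*=\frac{1}{n!}\sum_{\lambda}d_\lambda\,m_{d,\lambda}\,\lambda_{\max}(\rho_\lambda).$$ An optimal choice of POVM is given by $$M_\pi=P_\pi\Big(\bigoplus_{\lambda}\frac{m_{d,\lambda}}{d_\lambda^{\max}}\,\mathbb{I}_{\mathcal{V}_\lambda^d}\otimes\Pi^{\max}_{\rho_\lambda}\Big)P_\pi^\dagger,$$ where $\Pi^{\max}_{\rho_\lambda}$ is the projector onto the eigenspace of $\rho_\lambda$ corresponding to its largest eigenvalue and $d_\lambda^{\max}$ is the dimension of this maximal eigenspace.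
   Context: $\mathcal{U}_d$ is the unitary group on $\mathbb{C}^d$. For $\pi\in S_n$, $P_\pi(v_1\otimes\cdots\otimes v_n)=v_{\pi^{-1}(1)}\otimes\cdots\otimes v_{\pi^{-1}(n)}$ on $(\mathbb{C}^d)^{\otimes n}$. Schur-Weyl decomposition: $(\mathbb{C}^d)^{\otimes n}\cong\bigoplus_{\lambda\vdash_d n}\mathcal{V}_\lambda^d\otimes\mathcal{W}_\lambda$, where $\lambda\vdash_d n$ ranges over partitions of $n$ into at most $d$ parts (all sums over $\lambda$ are over this set), $\mathcal{V}_\lambda^d$ is an irreducible representation of $\mathcal{U}_d$ of dimension $m_{d,\lambda}$, $\mathcal{W}_\lambda$ is an irreducible representation of $S_n$ of dimension $d_\lambda$, and $P_\pi\cong\bigoplus_\lambda\mathbb{I}_{\mathcal{V}_\lambda^d}\otimes p_\lambda(\pi)$, $U^{\otimes n}\cong\bigoplus_\lambda q_\lambda(U)\otimes\mathbb{I}_{\mathcal{W}_\lambda}$ with $p_\lambda,q_\lambda$ the corresponding irreps. $\lambda_{\max}(\cdot)$ denotes the largest eigenvalue. A quantum state is a positive semidefinite operator of unit trace. A POVM is a family $(M_\pi)_{\pi\in S_n}$ of positive semidefinite operators with $\sum_\pi M_\pi=\mathbb{I}$; the optimal success probability $p_{\mathrm{succ}}^*$ is the maximum of $\frac{1}{n!}\sum_{\pi\in S_n}\operatorname{tr}(M_\pi\rho^\pi)$ over all POVMs, and a POVM attaining it is optimal.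
   Formalization: The weight m_{d,λ}/d_λ^max in the displayed POVM is corrected to d_λ/(n! d_λ^max); with the printed weight the M_π do not sum to the identity (e.g. n=1, d=2, ρ=I/2 gives M=2I). *)

(* Defs.v *)
From HB Require Import structures.
From mathcomp Require Import all_boot all_order all_algebra all_fingroup.
From mathcomp Require Import mxrepresentation.
From mathcomp Require Import mxtens.
From mathcomp Require classical_sets.

Set Implicit Arguments.
Unset Strict Implicit.
Unset Printing Implicit Defensive.

Import Order.TTheory GRing.Theory Num.Theory.
Local Open Scope ring_scope.
Local Open Scope sesquilinear_scope.

(* Operators are matrices acting on column vectors. *)

(* Partitions of n into at most d parts: weakly decreasing d-tuples, padded    *)
(* with zeros, of sum n.                                                       *)
Definition part (d n : nat) : finType :=
  {t : d.-tuple 'I_n.+1 |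
    sorted geq (map val t) && (sumn (map val t) == n)}.

Section Operators.
Variable C : numClosedFieldType.

(* The order of C is partial: 0 <= z means that z is a nonnegative real, so    *)
(* this forces A to be Hermitian.                                              *)
Definition psd (k : nat) (A : 'M[C]_k) : Prop :=
  forall v : 'cV[C]_k, 0 <= (v ^t* *m A *m v) ord0 ord0.

Definition quantum_state (k : nat) (rho : 'M[C]_k) : Prop :=
  psd rho /\ \tr rho = 1.

(* The default value 0 is returned only if no largest eigenvalue exists; a     *)
(* positive semidefinite matrix of positive size always has one.               *)
Definition lambda_max (k : nat) (A : 'M[C]_k) : C :=
  classical_sets.xget 0
    (fun x => eigenvalue A x /\ forall y, eigenvalue A y -> y <= x).

Definition max_eigenspace (k : nat) (A : 'M[C]_k) : 'M[C]_k :=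
  eigenspace A (lambda_max A).

(* The library's eigenspaces and orthogonal projectors concern row vectors;    *)
(* for Hermitian A the adjoints of the row eigenvectors are the column         *)
(* eigenvectors, and the projector is the same matrix.                         *)
Definition max_eigenproj (k : nat) (A : 'M[C]_k) : 'M[C]_k :=
  proj_ortho (max_eigenspace A).

Definition max_eigendim (k : nat) (A : 'M[C]_k) : nat :=
  \rank (max_eigenspace A).

(* Discrimination of an ensemble indexed by S_n with uniform priors.           *)
Definition povm (n k : nat) (M : 'S_n -> 'M[C]_k) : Prop :=
  (forall s, psd (M s)) /\ \sum_s M s = 1%:M.

Definition success_prob (n k : nat) (E M : 'S_n -> 'M[C]_k) : C :=
  (n`!%:R)^-1 * \sum_s \tr (M s *m E s).

Definition is_optimal_success (n k : nat) (E : 'S_n -> 'M[C]_k) (x : C) : Prop :=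
  (exists2 M, povm M & success_prob E M = x) /\
  (forall M, povm M -> success_prob E M <= x).

Definition optimal_povm (n k : nat) (E M : 'S_n -> 'M[C]_k) : Prop :=
  povm M /\ is_optimal_success E (success_prob E M).

(* The standard basis e_(f 0) (x) ... (x) e_(f (n-1)) of the n-th tensor power *)
(* of C^d is indexed by the functions f : 'I_n -> 'I_d.                        *)
Definition tdim (d n : nat) : nat := #|{ffun 'I_n -> 'I_d}|.

Definition tensor_power (d n : nat) (U : 'M[C]_d) : 'M[C]_(tdim d n) :=
  \matrix_(a, b) \prod_(i < n) U ((enum_val a : {ffun _}) i) ((enum_val b : {ffun _}) i).

(* P_s maps the basis vector e_g to e_(g \o s^-1).                             *)
Definition perm_op (d n : nat) (s : 'S_n) : 'M[C]_(tdim d n) :=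
  \matrix_(a, b)
    ([ffun i => (enum_val b : {ffun _}) ((s^-1)%g i)] == enum_val a)%:R.

Definition unitary_repr (d k : nat) (q : 'M[C]_d -> 'M[C]_k) : Prop :=
  q 1%:M = 1%:M /\
  (forall U V, U \is unitarymx -> V \is unitarymx -> q (U *m V) = q U *m q V).

(* A subspace is given by the transposes of its vectors, as the row space of   *)
(* a matrix W.                                                                 *)
Definition unitary_irr (d k : nat) (q : 'M[C]_d -> 'M[C]_k) : Prop :=
  [/\ unitary_repr q, (0 < k)%N &
      forall W : 'M[C]_k,
        (forall U, U \is unitarymx -> stablemx W (q U)^T) ->
        W != 0 -> row_full W].

Definition unitary_sim (d k l : nat)
    (q : 'M[C]_d -> 'M[C]_k) (r : 'M[C]_d -> 'M[C]_l) : Prop :=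
  exists2 A : 'M[C]_(k, l), row_free A && row_full A &
    forall U, U \is unitarymx -> q U *m A = A *m r U.

(* A Schur-Weyl decomposition: irreducible representations q_l of U_d on V_l   *)
(* and p_l of S_n on W_l, pairwise inequivalent, and a unitary isomorphism of  *)
(* the orthogonal direct sum of the V_l (x) W_l with the tensor power,         *)
(* compatible with both actions. The isomorphism is given by its restrictions  *)
(* sw_inj l to the summands, so that sum_l sw_inj l *m X l *m (sw_inj l)^* is  *)
(* the direct sum of the operators X l.                                        *)
(* Library permutations compose from left to right (s * t is t after s): if    *)
(* p is a representation in the sense of the library, then s |-> p s^-1 is the *)
(* corresponding left representation, acting on column vectors.                *)
Record schur_weyl (d n : nat) : Type := SchurWeyl {
  sw_m : part d n -> nat;
  sw_d : part d n -> nat;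
  sw_q : forall l, 'M[C]_d -> 'M[C]_(sw_m l);
  sw_rep : forall l, mx_representation C [set: 'S_n] (sw_d l);
  sw_inj : forall l, 'M[C]_(tdim d n, sw_m l * sw_d l);
  sw_q_irr : forall l, unitary_irr (sw_q l);
  sw_q_neq : forall l k, l != k -> ~ unitary_sim (sw_q l) (sw_q k);
  sw_rep_irr : forall l, mx_irreducible (sw_rep l);
  sw_rep_neq : forall l k, l != k -> ~ mx_rsim (sw_rep l) (sw_rep k);
  sw_injK : forall l, (sw_inj l) ^t* *m sw_inj l = 1%:M;
  sw_inj_ortho : forall l k, l != k -> (sw_inj l) ^t* *m sw_inj k = 0;
  sw_inj_total : \sum_l sw_inj l *m (sw_inj l) ^t* = 1%:M;
  sw_permE : forall s : 'S_n,
    perm_op d s =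
      \sum_l sw_inj l *m (1%:M *t sw_rep l (s^-1)%g) *m (sw_inj l) ^t*;
  sw_unitaryE : forall U, U \is unitarymx ->
    tensor_power n U =
      \sum_l sw_inj l *m (sw_q l U *t 1%:M) *m (sw_inj l) ^t* }.

Definition direct_sum (d n : nat) (S : schur_weyl d n)
    (X : forall l, 'M[C]_(sw_m S l * sw_d S l)) : 'M[C]_(tdim d n) :=
  \sum_l sw_inj S l *m X l *m (sw_inj S l) ^t*.

Definition gu_ensemble (d n : nat) (rho : 'M[C]_(tdim d n)) (s : 'S_n) :
    'M[C]_(tdim d n) :=
  perm_op d s *m rho *m (perm_op d s) ^t*.

Definition unitary_invariant (d n : nat) (rho : 'M[C]_(tdim d n)) : Prop :=
  forall U : 'M[C]_d, U \is unitarymx ->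
    tensor_power n U *m rho *m tensor_power n (U ^t*) = rho.

Definition sw_components (d n : nat) (S : schur_weyl d n)
    (rho : 'M[C]_(tdim d n)) (rhoL : forall l, 'M[C]_(sw_d S l)) : Prop :=
  (forall l, psd (rhoL l)) /\ rho = direct_sum (fun l => 1%:M *t rhoL l).

(* By Schur's lemma the sum over s in S_n of p_l(s) Pi p_l(s)^* is             *)
(* n! d_l^max / d_l times the identity of W_l, for Pi the projector onto the   *)
(* maximal eigenspace, whence the weight of the seed.                          *)
Definition max_povm (d n : nat) (S : schur_weyl d n)
    (rhoL : forall l, 'M[C]_(sw_d S l)) (s : 'S_n) : 'M[C]_(tdim d n) :=
  perm_op d s *m
  direct_sum (S := S) (fun l =>
    ((sw_d S l)%:R / (n`!%:R * (max_eigendim (rhoL l))%:R)) *: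
      (1%:M *t max_eigenproj (rhoL l))) *m
  (perm_op d s) ^t*.

End Operators.

(* Main.v *)
Require Import Defs.
From mathcomp Require Import all_boot all_order all_algebra all_fingroup.
From mathcomp Require Import mxrepresentation mxtens ring.
From mathcomp Require classical_sets.
From mathcomp Require Import reals complex.

(* Schur's lemma for U_d, applied to the m_l x m_k blocks of rho, gives the   *)
(* components rho_l. The operator K = (+)_l lambda_max(rho_l) I commutes with *)
(* every P_s and dominates rho, hence every rho^s, so that for a POVM M the   *)
(* sum of tr(M_s rho^s) is at most the sum of tr(M_s K), which is tr K. The   *)
(* seed of max_povm is supported where rho = K, so it attains the bound; by   *)
(* Schur's lemma for S_n its translates by the P_s sum to the identity.       *)

Set Implicit Arguments.
Unset Strict Implicit.
Unset Printing Implicit Defensive.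

Import Order.TTheory GRing.Theory Num.Theory.
Local Open Scope ring_scope.
Local Open Scope sesquilinear_scope.

(** Discrimination is a semidefinite program whose dual minimizes [\tr K / n!] over the Hermitian K
    that dominate every rho^s. With K constant equal to lambda_max(rho_l) on each isotypic summand,
    dual feasibility ([psd_dual_sub]) and weak duality ([success_prob_le], through [psd_trmul])
    bound every POVM. Complementary slackness dictates the optimum: M_s has to live where K and
    rho^s agree, that is, on the maximal eigenspaces transported by P_s, and there
    [max_eigenproj_mul] turns the bound into an equality ([success_prob_max_povm]). Completeness of
    this POVM is Schur averaging over S_n ([sw_rep_twirl]), whose constant fixes the weights
    ([max_povmP]). The components rho_l themselves come from Schur's lemma for U_d, applied to each
    matrix entry along the W factors ([sw_components_exist]). *)

Section Psd.
Variable C : numClosedFieldType.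

(** * Adjoints and positive semidefinite matrices *)

Lemma trmxC_mul m n p (A : 'M[C]_(m, n)) (B : 'M[C]_(n, p)) :
  (A *m B) ^t* = B ^t* *m A ^t*.
Proof. by rewrite trmx_mul map_mxM. Qed.

Lemma trmxC1 n : (1%:M : 'M[C]_n) ^t* = 1%:M.
Proof. by rewrite trmx1 map_mx1. Qed.

Lemma trmxC_tens m n p q (A : 'M[C]_(m, n)) (B : 'M[C]_(p, q)) :
  (A *t B) ^t* = A ^t* *t B ^t*.
Proof. by apply/matrixP => i j; rewrite !mxE rmorphM. Qed.

Lemma psd_gram m n (B : 'M[C]_(m, n)) : psd (B ^t* *m B).
Proof.
move=> v; rewrite !mulmxA -trmxC_mul -mulmxA mxE.
by apply: sumr_ge0 => i _; rewrite !mxE mulrC mul_conjC_ge0.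
Qed.

Lemma psd_sandwich m n (B : 'M[C]_(m, n)) (A : 'M[C]_n) :
  psd A -> psd (B *m A *m B ^t*).
Proof.
by move=> Apsd v; have := Apsd (B ^t* *m v); rewrite trmxC_mul trmxCK !mulmxA.
Qed.

Lemma psd_sum n (I : finType) (A : I -> 'M[C]_n) :
  (forall i, psd (A i)) -> psd (\sum_i A i).
Proof.
move=> Apsd v; rewrite mulmx_sumr mulmx_suml summxE.
by apply: sumr_ge0 => i _; apply: Apsd.
Qed.

Lemma psd_scale n a (A : 'M[C]_n) : 0 <= a -> psd A -> psd (a *: A).
Proof.
by move=> a_ge0 Apsd v; rewrite -scalemxAr -scalemxAl mxE mulr_ge0.
Qed.

Lemma psd_diag_mx n (r : 'rV[C]_n) : (forall i, 0 <= r 0 i) -> psd (diag_mx r).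
Proof.
move=> r_ge0 v; rewrite -mulmxA mxE; apply: sumr_ge0 => i _.
rewrite mul_diag_mx !mxE mulrCA mulr_ge0 //.
by rewrite mulrC mul_conjC_ge0.
Qed.

Lemma psd_diag n (A : 'M[C]_n) i : psd A -> 0 <= A i i.
Proof.
move=> /(_ (delta_mx i ord0)); rewrite -mulmxA -colE trmx_delta map_delta_mx.
by rewrite -rowE !mxE.
Qed.

Lemma psd_mxtrace n (A : 'M[C]_n) : psd A -> 0 <= \tr A.
Proof. by move=> Apsd; apply: sumr_ge0 => i _; apply: psd_diag. Qed.

(* Polarization: a sesquilinear form vanishing on the diagonal vanishes. *)
Lemma quad_form_eq0 n (A : 'M[C]_n) :
  (forall v : 'cV[C]_n, (v ^t* *m A *m v) 0 0 = 0) -> A = 0.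
Proof.
move=> A0; pose b (u v : 'cV[C]_n) := (u ^t* *m A *m v) 0 0.
have bD u v w z : b (u + v) (w + z) = b u w + b u z + (b v w + b v z).
  by rewrite /b [(u + v)^T]linearD /= map_mxD !mulmxDl !mulmxDr !mxE.
have bZl a u v : b (a *: u) v = a^* * b u v.
  by rewrite /b [(a *: u)^T]linearZ /= map_mxZ -!scalemxAl mxE.
have bZr a u v : b u (a *: v) = a * b u v.
  by rewrite /b -scalemxAr mxE.
have b_anti u v : b u v + b v u = 0.
  have := A0 (u + v); rewrite -[LHS]/(b _ _) bD.
  by rewrite [b u u]A0 [b v v]A0 add0r addr0.
have b0 u v : b u v = 0.
  have := b_anti ('i *: u) v; rewrite bZl bZr conjCi mulNr addrC -mulrBr.
  move=> /eqP; rewrite mulf_eq0 (negPf (neq0Ci C)) /= subr_eq0 => /eqP b_sym.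
  have := b_anti u v; rewrite b_sym -mulr2n => /eqP.
  by rewrite mulrn_eq0 /= => /eqP.
apply/matrixP => i j; have := b0 (delta_mx i ord0) (delta_mx j ord0).
rewrite /b -mulmxA -colE trmx_delta map_delta_mx -rowE !mxE //.
Qed.

(** The form of [A ^t* - A] at v is the conjugate of a nonnegative real minus that same real, so
    polarization applies. *)
Lemma psd_hermitian n (A : 'M[C]_n) : psd A -> A ^t* = A.
Proof.
move=> Apsd; apply/eqP; rewrite -subr_eq0; apply/eqP; apply: quad_form_eq0 => v.
have -> : v ^t* *m (A ^t* - A) *m v = (v ^t* *m A *m v) ^t* - v ^t* *m A *m v.
  by rewrite !trmxC_mul trmxCK mulmxBr mulmxBl mulmxA.
by move: (_ *m v) (Apsd v) => x x_ge0; rewrite !mxE (CrealP _) ?subrr ?ger0_real.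
Qed.

(** The spectral theorem for normal matrices; the last clause reduces questions about eigenvalues to
    the finite list of diagonal entries. *)
Lemma psd_spectral n (A : 'M[C]_n) : psd A ->
  exists U r, [/\ U \is unitarymx, A = U ^t* *m diag_mx r *m U,
     forall i : 'I_n, 0 <= r 0 i & forall x, eigenvalue A x <-> exists i, x = r 0 i].
Proof.
move=> Apsd; exists (spectralmx A), (spectral_diag A).
set U := spectralmx A; set r := spectral_diag A.
have Uu : U \is unitarymx := spectral_unitarymx A.
have UU : U *m U ^t* = 1%:M by apply/unitarymxP.
have U'U : U ^t* *m U = 1%:M by apply: mulmx1C.
have AE : A = U ^t* *m diag_mx r *m U.
  rewrite -invmx_unitary //; apply/orthomx_spectralP/normalmxP.
  by rewrite psd_hermitian.
have DE : U *m A *m U ^t* = diag_mx r.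
  by rewrite AE !mulmxA UU mul1mx -mulmxA UU mulmx1.
split=> // [i|x].
  have := psd_diag i (psd_sandwich U Apsd).
  by rewrite DE !mxE eqxx.
split=> [/eigenvalueP [v vA v0]|[i ->]].
  have wD : v *m U ^t* *m diag_mx r = x *: (v *m U ^t*).
    by rewrite -DE !mulmxA -(mulmxA v) U'U mulmx1 vA -scalemxAl.
  have w0 : v *m U ^t* != 0.
    by apply: contraNneq v0 => w0; rewrite -[v]mulmx1 -U'U mulmxA w0 mul0mx.
  (* In the coordinates of U the eigenvector has a nonzero entry, and there the eigenvalue equation
     reads r_i = x. *)
  have /rV0Pn [i wi0] := w0; exists i.
  move/rowP/(_ i): wD; rewrite mul_mx_diag !mxE mulrC => /(mulIf _) -> //.
  by rewrite mxE in wi0.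
apply/eigenvalueP; exists (row i U); last first.
  apply/eqP => Ui0; have := congr1 (row i) UU.
  rewrite row_mul Ui0 mul0mx => /rowP/(_ i).
  by rewrite !mxE eqxx => /esym/eqP; rewrite oner_eq0.
rewrite AE !mulmxA -row_mul UU row1 -rowE row_diag_mx -scalemxAl -rowE //.
Qed.

Lemma psd_factor n (A : 'M[C]_n) : psd A -> exists B : 'M[C]_n, A = B ^t* *m B.
Proof.
move=> /psd_spectral [U [r [Uu -> r_ge0 _]]].
pose s : 'rV[C]_n := \row_i sqrtC (r 0 i).
exists (diag_mx s *m U); rewrite trmxC_mul mulmxA -(mulmxA _ _ (diag_mx s)).
congr (_ *m _ *m _); rewrite tr_diag_mx map_diag_mx mulmx_diag; congr diag_mx.
apply/rowP => i; rewrite !mxE /= (CrealP _) ?ger0_real ?sqrtC_ge0 //.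
by rewrite -expr2 sqrtCK.
Qed.

Lemma psd_trmul n (A B : 'M[C]_n) : psd A -> psd B -> 0 <= \tr (A *m B).
Proof.
move=> Apsd /psd_factor [D ->]; rewrite mulmxA mxtrace_mulC mulmxA.
exact/psd_mxtrace/psd_sandwich.
Qed.

Lemma psd_tens1 m n (A : 'M[C]_n) : psd A -> psd ((1%:M : 'M[C]_m) *t A).
Proof.
move=> /psd_factor [B ->]; rewrite -[X in X *t _]mulmx1 -[X in (X *m _) *t _]trmxC1.
by rewrite -tensmx_mul -trmxC_tens; apply: psd_gram.
Qed.

Lemma psd_mxsub m n (A : 'M[C]_n) (f : 'I_m -> 'I_n) :
  psd A -> psd (mxsub f f A).
Proof.
move=> /psd_factor [B ->]; suff -> : mxsub f f (B ^t* *m B) =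
  (colsub f B) ^t* *m colsub f B by apply: psd_gram.
by apply/matrixP => i j; rewrite !mxE; apply: eq_bigr => k _; rewrite !mxE.
Qed.

(** * The largest eigenvalue and its eigenprojector *)

(** Rules out the default value of [lambda_max]: although the order of C is partial, the eigenvalues
    are finitely many reals, so a greatest one exists. *)
Lemma lambda_maxP n (A : 'M[C]_n) : (0 < n)%N -> psd A ->
  eigenvalue A (lambda_max A) /\
  forall y, eigenvalue A y -> y <= lambda_max A.
Proof.
move=> n_gt0 /psd_spectral [U [r [_ _ r_ge0 evE]]].
pose P x := eigenvalue A x /\ forall y, eigenvalue A y -> y <= x.
have [x Px] : exists x, P x.
  have r_real i : true -> r 0 i \is Num.real by rewrite ger0_real.
  have [i _ imax] := @real_arg_maxP _ _ (Ordinal n_gt0) xpredT (r 0) erefl r_real.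
  exists (r 0 i); split=> [|y]; first by apply/evE; exists i.
  by move=> /evE [j ->]; apply: imax.
exact: (classical_sets.xgetPex 0 (ex_intro _ x Px)).
Qed.

Lemma psd_lambda_max_sub n (A : 'M[C]_n) : (0 < n)%N -> psd A ->
  psd ((lambda_max A)%:M - A).
Proof.
move=> n_gt0 Apsd; have [_ le_max] := lambda_maxP n_gt0 Apsd.
have [U [r [Uu AE _ evE]]] := psd_spectral Apsd.
have UU : U ^t* *m U = 1%:M by apply: mulmx1C; apply/unitarymxP.
have -> : (lambda_max A)%:M - A =
    U ^t* *m diag_mx (const_mx (lambda_max A) - r) *m U.
  rewrite raddfB /= mulmxBr mulmxBl -AE diag_const_mx mul_mx_scalar -scalemxAl.
  by rewrite UU scalemx1.
rewrite -{2}[U]trmxCK; apply/psd_sandwich/psd_diag_mx => i.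
by rewrite !mxE subr_ge0; apply: le_max; apply/evE; exists i.
Qed.

(** In a rank factorization P = C R, idempotence and cancellation of the full-rank factors force R C
    = 1, of size the rank. *)
Lemma mxtrace_idempotent n (P : 'M[C]_n) : P *m P = P -> \tr P = (\rank P)%:R.
Proof.
move=> PP; suff RC : row_base P *m col_base P = 1%:M.
  by rewrite -{1}[P]mulmx_base mxtrace_mulC RC mxtrace1.
apply: (row_full_inj (col_base_full P)); apply: (row_free_inj (row_base_free P)).
by rewrite mulmx1 (mulmxA (col_base P)) mulmx_base -mulmxA mulmx_base.
Qed.

(** The rows of 1 - P are orthogonal to those of P, so P^* = P P^*, which is self-adjoint. *)
Lemma proj_ortho_hermitian m n (U : 'M[C]_(m, n)) :
  (proj_ortho U) ^t* = proj_ortho U.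
Proof.
set P := proj_ortho U.
have : (1%:M - P) *m P ^t* = 0.
  apply/orthomx1P; rewrite /P -{1}[proj_ortho U]mul1mx.
  rewrite (eqmx_ortho _ (proj_orthoE U)).
  exact: proj_ortho_compl_sub.
rewrite mulmxBl mul1mx => /eqP; rewrite subr_eq0 => /eqP PE.
move: P PE => {}P PE; by rewrite -[RHS]trmxCK [in RHS]PE trmxC_mul trmxCK -PE.
Qed.

Lemma psd_proj_ortho m n (U : 'M[C]_(m, n)) : psd (proj_ortho U).
Proof.
by rewrite -proj_ortho_proj -{1}proj_ortho_hermitian; apply: psd_gram.
Qed.

Lemma mxtrace_max_eigenproj n (A : 'M[C]_n) :
  \tr (max_eigenproj A) = (max_eigendim A)%:R.
Proof.
by rewrite mxtrace_idempotent ?proj_orthoE ?proj_ortho_proj.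
Qed.

Lemma max_eigenproj_mul n (A : 'M[C]_n) :
  max_eigenproj A *m A = lambda_max A *: max_eigenproj A.
Proof. by apply/eigenspaceP; rewrite proj_orthoE. Qed.

Lemma max_eigendim_gt0 n (A : 'M[C]_n) :
  (0 < n)%N -> psd A -> (0 < max_eigendim A)%N.
Proof.
by move=> n_gt0 /(lambda_maxP n_gt0) [ev _]; rewrite lt0n mxrank_eq0.
Qed.

End Psd.

(** * Schur's lemma *)

Section Schur.
Variable C : numClosedFieldType.

(** A common form of irreducibility, on row vectors, for representations of the finite group S_n and
    for maps that are multiplicative only on unitary matrices. *)
Definition irr_family (I : Type) (D : I -> Prop) m (A : I -> 'M[C]_m) : Prop :=
  forall W : 'M[C]_m, (forall i, D i -> stablemx W (A i)) -> W != 0 -> row_full W.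

(** The left kernel of Y is stable under A and its row space under B; irreducibility makes the
    former zero and the latter everything. *)
Lemma schur_bij (I : Type) (D : I -> Prop) m k (A : I -> 'M[C]_m)
    (B : I -> 'M[C]_k) (Y : 'M[C]_(m, k)) :
  irr_family D A -> irr_family D B ->
  (forall i, D i -> A i *m Y = Y *m B i) -> Y != 0 -> row_free Y && row_full Y.
Proof.
move=> irrA irrB AYB Y0; apply/andP; split.
  rewrite -kermx_eq0; apply: contraNT Y0 => ker0.
  have [i Di|V VK] := row_fullP (irrA (kermx Y) _ ker0).
    by apply/sub_kermxP; rewrite -mulmxA AYB // mulmxA mulmx_ker mul0mx.
  by rewrite -[Y]mul1mx -VK -mulmxA mulmx_ker mulmx0.
have := irrB <<Y>>%MS; rewrite -!mxrank_eq0 genmxE mxrank_eq0.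
rewrite /row_full genmxE; apply=> // i Di.
by rewrite genmxE (eqmxMr _ (genmxE Y)) -AYB // submxMl.
Qed.

(** For an eigenvalue a of Y, the intertwiner Y - a is singular, hence zero by [schur_bij]. *)
Lemma schur_scalar (I : Type) (D : I -> Prop) m (A : I -> 'M[C]_m) (Y : 'M[C]_m) :
  (0 < m)%N -> irr_family D A -> (forall i, D i -> A i *m Y = Y *m A i) ->
  exists a, Y = a%:M.
Proof.
move=> m_gt0 irrA AY; have [a Ya] := eigenvalue_closed Y m_gt0; exists a.
apply/eqP; rewrite -subr_eq0; apply: contraTT Ya => Z0.
rewrite /eigenvalue /eigenspace negbK kermx_eq0.
suff /andP [] : row_free (Y - a%:M) && row_full (Y - a%:M) by [].
apply: (schur_bij irrA irrA _ Z0) => i Di.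
by rewrite mulmxBr mulmxBl AY // scalar_mxC.
Qed.

Lemma mx_irr_family gT (G : {group gT}) m (rG : mx_representation C G m) :
  mx_irreducible rG -> irr_family (fun x => x \in G) rG.
Proof. by move=> /mx_irrP [_ simM] W Wst; apply: simM; apply/mxmoduleP. Qed.

Lemma unitary_irr_family d k (q : 'M[C]_d -> 'M[C]_k) :
  unitary_irr q -> irr_family (fun U => U \is unitarymx) (fun U => (q U)^T).
Proof. by case. Qed.

Lemma tr_intertwine m k (P : 'M[C]_m) (Q : 'M[C]_k) (Y : 'M[C]_(m, k)) :
  P *m Y = Y *m Q -> Q^T *m Y^T = Y^T *m P^T.
Proof. by rewrite -!trmx_mul => ->. Qed.

Lemma unitary_schur_eq0 d m k (q : 'M[C]_d -> 'M[C]_m) (r : 'M[C]_d -> 'M[C]_k)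
    (Y : 'M[C]_(m, k)) :
  unitary_irr q -> unitary_irr r -> ~ unitary_sim q r ->
  (forall U, U \is unitarymx -> q U *m Y = Y *m r U) -> Y = 0.
Proof.
move=> /unitary_irr_family irrq /unitary_irr_family irrr neq_qr qYr.
apply/eqP; apply/negPn/negP => Y0; apply: neq_qr; exists Y => //.
(* Irreducibility concerns the transposes, so Schur's lemma is applied to Y^T, which intertwines in
   the opposite direction. *)
rewrite /row_free /row_full -mxrank_tr andbC.
apply: (schur_bij irrr irrq); last by rewrite trmx_eq0.
by move=> U /qYr /tr_intertwine.
Qed.

Lemma unitary_schur_scalar d m (q : 'M[C]_d -> 'M[C]_m) (Y : 'M[C]_m) :
  unitary_irr q -> (forall U, U \is unitarymx -> q U *m Y = Y *m q U) ->
  exists a, Y = a%:M.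
Proof.
move=> irrq qY; have [_ m_gt0 _] := irrq.
have [|a Ya] := @schur_scalar _ _ _ _ Y^T m_gt0 (unitary_irr_family irrq).
  by move=> U /qY /tr_intertwine.
by exists a; rewrite -[Y]trmxK Ya tr_scalar_mx.
Qed.

End Schur.

(** * Blocks of operators on tensor products *)

Section Tensor.
Variable C : numClosedFieldType.

Lemma tensmx11 m n : (1%:M : 'M[C]_m) *t (1%:M : 'M[C]_n) = 1%:M.
Proof.
apply/matrixP => i j; case: (mxtens_indexP i) => a b; case: (mxtens_indexP j) => c e.
rewrite tensmxE !mxE (can_eq (@mxtens_indexK _ _)) xpair_eqE.
by rewrite -mulnb natrM.
Qed.

Lemma mxtrace_tens m n (A : 'M[C]_m) (B : 'M[C]_n) :
  \tr (A *t B) = \tr A * \tr B.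
Proof. by rewrite /mxtrace mulr_sum; apply: eq_bigr => i _; rewrite mxE. Qed.

Lemma tens1mx_inj m n p : (0 < m)%N ->
  injective (fun A : 'M[C]_(n, p) => (1%:M : 'M[C]_m) *t A).
Proof.
move=> m_gt0 A B AB; apply/matrixP => i j; pose a := Ordinal m_gt0.
have := congr1 (fun X : 'M_(_, _) => X (mxtens_index (a, i)) (mxtens_index (a, j))) AB.
by rewrite !tensmxE mxE eqxx !mul1r.
Qed.

(** Fixing the indices of the second factors leaves an operator between the first factors, where U_d
    acts; invariance then passes to each block. *)
Definition tens_block m k a b (X : 'M[C]_(m * a, k * b)) i j : 'M[C]_(m, k) :=
  mxsub (fun u => mxtens_index (u, i)) (fun v => mxtens_index (v, j)) X.

Lemma tens_block_mull m k a b (P : 'M[C]_m) (X : 'M[C]_(m * a, k * b)) i j :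
  tens_block ((P *t 1%:M) *m X) i j = P *m tens_block X i j.
Proof.
apply/matrixP => u v; rewrite !mxE.
transitivity (\sum_w \sum_c (P *t 1%:M) (mxtens_index (u, i)) (mxtens_index (w, c)) *
    X (mxtens_index (w, c)) (mxtens_index (v, j))).
  rewrite pair_bigA (reindex (@mxtens_index m a)) /=.
    by apply: eq_bigr => -[].
  by exists (@mxtens_unindex m a) => w _; rewrite (mxtens_indexK, mxtens_unindexK).
apply: eq_bigr => w _; rewrite (bigD1 i) //= big1 => [|c ci].
  by rewrite addr0 tensmxE !mxE eqxx mulr1.
by rewrite tensmxE mxE eq_sym (negPf ci) mulr0 mul0r.
Qed.

Lemma tens_block_tr m k a b (X : 'M[C]_(m * a, k * b)) i j :
  tens_block X^T j i = (tens_block X i j)^T.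
Proof. by apply/matrixP => u v; rewrite !mxE. Qed.

Lemma tens_block_mulr m k a b (Q : 'M[C]_k) (X : 'M[C]_(m * a, k * b)) i j :
  tens_block (X *m (Q *t 1%:M)) i j = tens_block X i j *m Q.
Proof.
apply: trmx_inj; rewrite -tens_block_tr trmx_mul trmx_tens trmx1.
by rewrite tens_block_mull trmx_mul tens_block_tr.
Qed.

Lemma tens_blockP m k a b (X Y : 'M[C]_(m * a, k * b)) :
  (forall i j, tens_block X i j = tens_block Y i j) -> X = Y.
Proof.
move=> XY; apply/matrixP => u v.
case: (mxtens_indexP u) => i c; case: (mxtens_indexP v) => j e.
by have /matrixP/(_ i j) := XY c e; rewrite !mxE.
Qed.

End Tensor.

(** * Calculus of direct sums and the action of S_n *)

Section SchurWeyl.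
Variables (C : numClosedFieldType) (d n : nat) (S : schur_weyl C d n).

Lemma perm_op_unitary (s : 'S_n) : (@perm_op C d n s) ^t* *m perm_op C d s = 1%:M.
Proof.
pose h (b : 'I_(tdim d n)) : 'I_(tdim d n) :=
  enum_rank [ffun i => (enum_val b : {ffun 'I_n -> 'I_d}) ((s^-1)%g i)].
have h_inj : injective h.
  move=> a b /enum_rank_inj /ffunP eq_ab; apply/enum_val_inj/ffunP => i.
  by have := eq_ab (s i); rewrite !ffunE permK.
have PE a b : perm_op C d s a b = (h b == a)%:R.
  by rewrite mxE -(inj_eq enum_val_inj) enum_rankK.
move: (perm_op C d s) PE => P PE.
apply/matrixP => a b; rewrite !mxE (bigD1 (h a)) //= big1 => [|c cha].
  by rewrite !mxE !PE eqxx rmorph1 mul1r addr0 (inj_eq h_inj) eq_sym.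
by rewrite !mxE PE eq_sym (negPf cha) rmorph0 mul0r.
Qed.

Lemma direct_sum_inj (X : forall l, 'M[C]_(sw_m S l * sw_d S l)) k :
  direct_sum X *m sw_inj S k = sw_inj S k *m X k.
Proof.
rewrite mulmx_suml (bigD1 k) //= -!mulmxA sw_injK mulmx1 big1 ?addr0 // => l lk.
by rewrite -!mulmxA sw_inj_ortho // !mulmx0.
Qed.

Lemma inj_direct_sum (X : forall l, 'M[C]_(sw_m S l * sw_d S l)) k :
  (sw_inj S k) ^t* *m direct_sum X = X k *m (sw_inj S k) ^t*.
Proof.
rewrite mulmx_sumr (bigD1 k) //= !mulmxA sw_injK mul1mx big1 ?addr0 // => l lk.
by rewrite !mulmxA sw_inj_ortho 1?eq_sym // !mul0mx.
Qed.

Lemma eq_direct_sum (X Y : forall l, 'M[C]_(sw_m S l * sw_d S l)) :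
  (forall l, X l = Y l) -> direct_sum X = direct_sum Y.
Proof. by move=> XY; apply: eq_bigr => l _; rewrite XY. Qed.

Lemma direct_sum_mul (X Y : forall l, 'M[C]_(sw_m S l * sw_d S l)) :
  direct_sum X *m direct_sum Y = direct_sum (fun l => X l *m Y l).
Proof.
rewrite [X in _ *m X]/direct_sum mulmx_sumr; apply: eq_bigr => l _.
by rewrite !mulmxA direct_sum_inj.
Qed.

Lemma direct_sum_adj (X : forall l, 'M[C]_(sw_m S l * sw_d S l)) :
  (direct_sum X) ^t* = direct_sum (fun l => (X l) ^t*).
Proof.
rewrite /direct_sum raddf_sum map_mx_sum; apply: eq_bigr => l _.
by rewrite !trmxC_mul trmxCK mulmxA.
Qed.

Lemma direct_sumB (X Y : forall l, 'M[C]_(sw_m S l * sw_d S l)) :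
  direct_sum (fun l => X l - Y l) = direct_sum X - direct_sum Y.
Proof.
by rewrite /direct_sum -sumrB; apply: eq_bigr => l _; rewrite mulmxBr mulmxBl.
Qed.

Lemma direct_sum1 : direct_sum (fun l => 1%:M : 'M[C]_(sw_m S l * sw_d S l)) = 1%:M.
Proof. by rewrite -(sw_inj_total S); apply: eq_bigr => l _; rewrite mulmx1. Qed.

Lemma mxtrace_direct_sum (X : forall l, 'M[C]_(sw_m S l * sw_d S l)) :
  \tr (direct_sum X) = \sum_l \tr (X l).
Proof.
rewrite raddf_sum; apply: eq_bigr => l _.
by rewrite /= -mulmxA mxtrace_mulC -mulmxA sw_injK mulmx1.
Qed.

Lemma psd_direct_sum (X : forall l, 'M[C]_(sw_m S l * sw_d S l)) :
  (forall l, psd (X l)) -> psd (direct_sum X).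
Proof. by move=> Xpsd; apply: psd_sum => l; apply: psd_sandwich. Qed.

Lemma sw_m_gt0 l : (0 < sw_m S l)%N.
Proof. by have [] := sw_q_irr S l. Qed.

Lemma sw_d_gt0 l : (0 < sw_d S l)%N.
Proof. by have /mx_irrP [] := sw_rep_irr S l. Qed.

Lemma perm_op_direct_sum (s : 'S_n) :
  perm_op C d s = direct_sum (fun l => 1%:M *t sw_rep S l (s^-1)%g).
Proof. exact: sw_permE. Qed.

Lemma tensor_power_direct_sum (U : 'M[C]_d) : U \is unitarymx ->
  tensor_power n U = direct_sum (fun l => sw_q S l U *t 1%:M).
Proof. exact: sw_unitaryE. Qed.

(** Unitarity of the irreps of S_n is inherited from that of P_s, compressed to the summand l and
    stripped of the identity on V_l. *)
Lemma sw_rep_adj l (s : 'S_n) : (sw_rep S l s) ^t* = sw_rep S l (s^-1)%g.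
Proof.
have uni : (sw_rep S l s) ^t* *m sw_rep S l s = 1%:M.
  apply: (tens1mx_inj (sw_m_gt0 l)); rewrite /= tensmx11.
  have := perm_op_unitary (s^-1)%g.
  rewrite perm_op_direct_sum invgK direct_sum_adj direct_sum_mul -direct_sum1.
  move=> /(congr1 (mulmx (map_mx Num.conj (sw_inj S l)^T))).
  rewrite !inj_direct_sum mul1mx.
  move=> /(congr1 (mulmx^~ (sw_inj S l))); rewrite -!mulmxA sw_injK !mulmx1.
  by rewrite trmxC_tens tensmx_mul trmxC1 mulmx1.
rewrite -[LHS]mulmx1 -(repr_mx1 (sw_rep S l)) -(mulgV s) repr_mxM ?inE //.
by rewrite mulmxA uni mul1mx.
Qed.

(** The average commutes with the irrep by reindexing the group, so it is scalar; its trace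
    determines the scalar. *)
Lemma sw_rep_twirl l (A : 'M[C]_(sw_d S l)) :
  \sum_(s : 'S_n) sw_rep S l s *m A *m (sw_rep S l s) ^t* =
  (n`!%:R * \tr A / (sw_d S l)%:R)%:M.
Proof.
set T := \sum_s _; set r := sw_rep S l.
have rT t : r t *m T = T *m r t.
  rewrite mulmx_sumr mulmx_suml (reindex_inj (mulgI t^-1)%g) /=.
  apply: eq_bigr => s _; rewrite !sw_rep_adj !mulmxA -/r.
  rewrite -repr_mxM ?inE // mulKVg -!mulmxA -repr_mxM ?inE //.
  by rewrite invMg invgK.
have [|a Ta] := schur_scalar (Y := T) (sw_d_gt0 l) (mx_irr_family (sw_rep_irr S l)).
  by move=> t _; apply: rT.
have trT : \tr T = n`!%:R * \tr A.
  rewrite raddf_sum (eq_bigr (fun=> \tr A)) => [|s _].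
    by rewrite sumr_const card_Sn mulr_natl.
  by rewrite /= mxtrace_mulC sw_rep_adj mulmxA -repr_mxM ?inE // mulVg repr_mx1 mul1mx.
rewrite Ta; congr (_%:M); rewrite -trT Ta mxtrace_scalar -[a *+ _]mulr_natr mulfK //.
by rewrite pnatr_eq0 -lt0n sw_d_gt0.
Qed.

(** * Unitary invariance and the components of rho *)

Lemma tensor_powerM (U V : 'M[C]_d) : U \is unitarymx -> V \is unitarymx ->
  tensor_power n U *m tensor_power n V = tensor_power n (U *m V).
Proof.
move=> Uu Vu; rewrite !tensor_power_direct_sum ?mul_unitarymx // direct_sum_mul.
apply: eq_direct_sum => l; rewrite tensmx_mul mulmx1.
by have [[_ ->]] := sw_q_irr S l.
Qed.

Lemma tensor_power1 : tensor_power n (1%:M : 'M[C]_d) = 1%:M.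
Proof.
rewrite tensor_power_direct_sum; last by apply/unitarymxP; rewrite trmxC1 mulmx1.
rewrite -direct_sum1; apply: eq_direct_sum => l.
by have [[-> _] _ _] := sw_q_irr S l; rewrite tensmx11.
Qed.

Lemma unitary_invariant_comm rho (U : 'M[C]_d) :
  unitary_invariant rho -> U \is unitarymx ->
  tensor_power n U *m rho = rho *m tensor_power n U.
Proof.
move=> rho_inv Uu; rewrite -{2}(rho_inv U Uu) -!mulmxA.
have Uu' : U ^t* \is unitarymx by rewrite trmxC_unitary.
rewrite tensor_powerM // (mulmx1C (elimT unitarymxP Uu)).
by rewrite tensor_power1 mulmx1.
Qed.

Definition sw_block (rho : 'M[C]_(tdim d n)) l k :
    'M[C]_(sw_m S l * sw_d S l, sw_m S k * sw_d S k) :=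
  (sw_inj S l) ^t* *m rho *m sw_inj S k.

Lemma sw_block_comm rho l k (U : 'M[C]_d) : unitary_invariant rho -> U \is unitarymx ->
  (sw_q S l U *t 1%:M) *m sw_block rho l k =
  sw_block rho l k *m (sw_q S k U *t 1%:M).
Proof.
move=> rho_inv Uu; rewrite /sw_block -[RHS]mulmxA.
rewrite -(direct_sum_inj (fun k => sw_q S k U *t 1%:M)) -tensor_power_direct_sum //.
rewrite [RHS]mulmxA -[in RHS](mulmxA _ rho) -unitary_invariant_comm //.
by rewrite !mulmxA tensor_power_direct_sum // inj_direct_sum.
Qed.

(** Every [tens_block] of a Schur-Weyl block of rho intertwines two irreps of U_d: it vanishes off
    the diagonal and is scalar on it, so a diagonal block has the form 1 (x) rho_l. *)
Lemma sw_components_exist rho : psd rho -> unitary_invariant rho ->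
  exists rhoL : forall l, 'M[C]_(sw_d S l), sw_components rho rhoL.
Proof.
move=> rho_psd rho_inv; pose X l := sw_block rho l l.
(* Since the blocks will turn out to be scalar, any fixed basis vector of V_l reads off rho_l; this
   choice makes rho_l a principal submatrix, hence positive. *)
pose o l := Ordinal (sw_m_gt0 l).
exists (fun l => mxsub (fun i => mxtens_index (o l, i))
                       (fun i => mxtens_index (o l, i)) (X l)).
split=> [l|].
  apply/psd_mxsub; rewrite /X /sw_block -{2}[sw_inj S l]trmxCK.
  exact: psd_sandwich.
have blockq l k i j U : U \is unitarymx ->
    sw_q S l U *m tens_block (sw_block rho l k) i j =
    tens_block (sw_block rho l k) i j *m sw_q S k U.
  by move=> Uu; rewrite -tens_block_mull -tens_block_mulr sw_block_comm.
have X_off l k : l != k -> sw_block rho l k = 0.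
  move=> lk; apply: tens_blockP => i j; rewrite [RHS](_ : _ = 0); last first.
    by apply/matrixP => u v; rewrite !mxE.
  exact: unitary_schur_eq0 (sw_q_irr S l) (sw_q_irr S k) (sw_q_neq lk) (@blockq l k i j).
have X_diag l : X l = 1%:M *t mxsub (fun i => mxtens_index (o l, i))
                                    (fun i => mxtens_index (o l, i)) (X l).
  apply/tens_blockP => i j.
  have [a] := unitary_schur_scalar (sw_q_irr S l) (@blockq l l i j).
  rewrite -/(X l); move: (X l) => Z Za; apply/matrixP => u v.
  have aE : a = Z (mxtens_index (o l, i)) (mxtens_index (o l, j)).
    by move/matrixP/(_ (o l) (o l)): Za; rewrite !mxE eqxx => ->.
  by rewrite Za [RHS]mxE tensmxE [mxsub _ _ Z _ _]mxE -aE !mxE mulr_natl.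
(* Inserting the resolution of the identity on both sides splits rho into its blocks. *)
transitivity (\sum_l \sum_k sw_inj S l *m sw_block rho l k *m (sw_inj S k) ^t*).
  rewrite -[LHS]mul1mx -[LHS]mulmx1 -{1}(sw_inj_total S) -(sw_inj_total S).
  rewrite !mulmx_suml; apply: eq_bigr => l _; rewrite mulmx_sumr.
  by apply: eq_bigr => k _; rewrite /sw_block !mulmxA.
apply: eq_bigr => l _; rewrite (bigD1 l) //= big1 => [|k kl].
  by rewrite addr0 -X_diag.
by rewrite X_off 1?eq_sym // mulmx0 mul0mx.
Qed.

(** * The dual bound and the POVM that attains it *)

Lemma fact_neq0 : n`!%:R != 0 :> C.
Proof. by rewrite pnatr_eq0 -lt0n fact_gt0. Qed.

Section Optimality.
Variables (rho : 'M[C]_(tdim d n)) (rhoL : forall l, 'M[C]_(sw_d S l)).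
Hypothesis rhoP : sw_components rho rhoL.

Let opt : C := (n`!%:R)^-1 *
  \sum_l (sw_d S l)%:R * (sw_m S l)%:R * lambda_max (rhoL l).

(* The operator K of the header. *)
Let dual := direct_sum (S := S) (fun l => (lambda_max (rhoL l))%:M).

Lemma mxtrace_dual :
  \tr dual = \sum_l (sw_d S l)%:R * (sw_m S l)%:R * lambda_max (rhoL l).
Proof.
rewrite mxtrace_direct_sum; apply: eq_bigr => l _.
by rewrite mxtrace_scalar -[lambda_max _ *+ _]mulr_natl natrM [_ * _%:R]mulrC.
Qed.

(** K is scalar on each summand, so it commutes with P_s, and K - rho^s is the conjugate of K - rho
    by P_s; positivity is then checked on each rho_l. *)
Lemma psd_dual_sub s : psd (dual - gu_ensemble rho s).
Proof.
have [rhoL_psd ->] := rhoP.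
have -> : dual = perm_op C d s *m dual *m (perm_op C d s) ^t*.
  rewrite perm_op_direct_sum direct_sum_mul.
  under eq_direct_sum do rewrite scalar_mxC.
  rewrite -direct_sum_mul -mulmxA -perm_op_direct_sum.
  by rewrite (mulmx1C (perm_op_unitary s)) mulmx1.
rewrite /gu_ensemble -mulmxBl -mulmxBr; apply: psd_sandwich.
rewrite -direct_sumB; apply: psd_direct_sum => l.
have -> : (lambda_max (rhoL l))%:M - 1%:M *t rhoL l =
    (1%:M : 'M[C]_(sw_m S l)) *t ((lambda_max (rhoL l))%:M - rhoL l).
  apply/matrixP => i j; rewrite -[(_)%:M in LHS]scalemx1 -tensmx11.
  by rewrite -(scalemx1 _ (lambda_max _)) !mxE mulrBr mulrCA.
apply/psd_tens1/psd_lambda_max_sub; [exact: sw_d_gt0|exact: rhoL_psd].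
Qed.

(** Completeness of M collapses the sum of tr(M_s K) to tr K, whatever M is. *)
Lemma success_prob_le M : povm M -> success_prob (gu_ensemble rho) M <= opt.
Proof.
move=> [Mpsd M1]; rewrite /success_prob /opt ler_wpM2l ?invr_ge0 ?ler0n //.
rewrite -mxtrace_dual -[dual]mul1mx -M1 mulmx_suml raddf_sum.
apply: ler_sum => s _; have := psd_trmul (Mpsd s) (psd_dual_sub s).
by rewrite mulmxBr raddfB subr_ge0.
Qed.

Let weight l : C := (sw_d S l)%:R / (n`!%:R * (max_eigendim (rhoL l))%:R).

Lemma max_eigendim_neq0 l : (max_eigendim (rhoL l))%:R != 0 :> C.
Proof.
by rewrite pnatr_eq0 -lt0n max_eigendim_gt0 ?sw_d_gt0 //; have [] := rhoP.
Qed.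

Lemma max_povmP : povm (max_povm rhoL).
Proof.
split=> [s|].
  apply/psd_sandwich/psd_direct_sum => l; apply/psd_scale/psd_tens1/psd_proj_ortho.
  by rewrite divr_ge0 ?mulr_ge0 ?ler0n.
pose r l s := sw_rep S l s.
have MsE s : max_povm rhoL s = direct_sum (S := S) (fun l => weight l *:
    (1%:M *t (r l s^-1%g *m max_eigenproj (rhoL l) *m (r l s^-1%g) ^t*))).
  rewrite /max_povm perm_op_direct_sum direct_sum_adj !direct_sum_mul.
  apply: eq_direct_sum => l; rewrite -scalemxAr -scalemxAl trmxC_tens !tensmx_mul.
  by rewrite trmxC1 !mulmx1.
rewrite (eq_bigr _ (fun s _ => MsE s)) -direct_sum1 exchange_big /=.
apply: eq_bigr => l _; rewrite -mulmx_suml -mulmx_sumr; congr (_ *m _ *m _).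
(* The operator P_s carries the library representation at s^-1, so the sum is reindexed by inversion
   before averaging. *)
rewrite -scaler_sumr (reindex_inj invg_inj) /=.
under eq_bigr do rewrite invgK.
transitivity (weight l *: ((1%:M : 'M[C]_(sw_m S l)) *t
    \sum_s r l s *m max_eigenproj (rhoL l) *m (r l s) ^t*)).
  congr (_ *: _); apply/matrixP => i j; rewrite summxE [RHS]mxE summxE mulr_sumr.
  by apply: eq_bigr => s _; rewrite mxE.
rewrite sw_rep_twirl mxtrace_max_eigenproj.
(* The weight is the reciprocal of the scalar produced by averaging the eigenprojector, whose trace
   is d_l^max. *)
have wK : weight l * (n`!%:R * (max_eigendim (rhoL l))%:R / (sw_d S l)%:R) = 1.
  by rewrite mulf_div [X in _ / X]mulrC divff ?mulf_neq0 ?max_eigendim_neq0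
    ?fact_neq0 // pnatr_eq0 -lt0n sw_d_gt0.
apply/matrixP => i j; rewrite -tensmx11 -[(_ / _)%:M]scalemx1 !mxE.
by rewrite mulrCA [weight l * _]mulrA wK mul1r.
Qed.

(** Under the trace the conjugations by P_s cancel, so all n! terms are equal; in each, the seed
    turns rho_l into lambda_max(rho_l), and d_l^max cancels against the weight. *)
Lemma success_prob_max_povm : success_prob (gu_ensemble rho) (max_povm rhoL) = opt.
Proof.
have [_ rhoE] := rhoP; rewrite /success_prob /opt; congr (_ * _).
pose seed := direct_sum (S := S)
  (fun l => weight l *: (1%:M *t max_eigenproj (rhoL l))).
transitivity (\sum_(s : 'S_n) \tr (seed *m rho)).
  apply: eq_bigr => s _; rewrite /max_povm /gu_ensemble !mulmxA
    -[in LHS](mulmxA _ _ (perm_op C d s)).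
  by rewrite perm_op_unitary mulmx1 mxtrace_mulC !mulmxA perm_op_unitary mul1mx.
rewrite sumr_const -cardsT /= cardsT card_Sn -mulr_natl rhoE direct_sum_mul.
rewrite mxtrace_direct_sum mulr_sumr; apply: eq_bigr => l _.
rewrite -scalemxAl tensmx_mul mulmx1 max_eigenproj_mul mxtraceZ mxtrace_tens.
rewrite mxtraceZ mxtrace1 mxtrace_max_eigenproj /weight.
have k0 := max_eigendim_neq0 l; have f0 := fact_neq0.
by field; rewrite k0.
Qed.

End Optimality.
End SchurWeyl.

Theorem proposition12 (R : realType) (d n : nat) (S : schur_weyl R[i] d n)
    (rho : 'M[R[i]]_(tdim d n)) (rho_state : quantum_state rho)
    (rho_inv : unitary_invariant rho) :
  (exists rhoL : forall l, 'M[R[i]]_(sw_d S l), sw_components rho rhoL) /\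
  (forall rhoL : forall l, 'M[R[i]]_(sw_d S l), sw_components rho rhoL ->
     is_optimal_success (gu_ensemble rho)
       ((n`!%:R)^-1 *
        \sum_l (sw_d S l)%:R * (sw_m S l)%:R * lambda_max (rhoL l)) /\
     optimal_povm (gu_ensemble rho) (max_povm rhoL)).
Proof.
have [rho_psd _] := rho_state.
split=> [|rhoL rhoP]; first exact: sw_components_exist.
have opt : is_optimal_success (gu_ensemble rho)
    ((n`!%:R)^-1 *
     \sum_l (sw_d S l)%:R * (sw_m S l)%:R * lambda_max (rhoL l)).
  split; last exact: success_prob_le.
  by exists (max_povm rhoL); [apply: max_povmP rhoP | apply: success_prob_max_povm].
split=> //; split; first exact: max_povmP rhoP.
by rewrite success_prob_max_povm.
Qed.
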